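(* Let $D=\bigcup_{n\in\mathbb{N}_0}\mathbb{Q}[X^{\frac{1}{2^n}},X^{-\frac{1}{2^n}}]$. Then each nonzero nonunit of $D$ can be written uniquely as a product of countably many prime elements of $D$. That is, for each nonzero nonunit $f$ of $D$ there is a unique family $\{k_p\}_{p\in S}$ of nonnegative integers such that $f=u_f\prod_{p\in S}p^{k_p}$ in the sense of the infinite product defined in the context, where the set $S$ is countable.
   Context: $\mathbb{N}_0$ is the set of nonnegative integers, $X$ is an indeterminate over $\mathbb{Q}$, and the elements $X^{1/2^n}$ are compatible roots of $X$, i.e. $(X^{1/2^{n+1}})^2=X^{1/2^n}$. Let $R=\bigcup_{n\in\mathbb{N}_0}\mathbb{Q}[X^{\frac{1}{2^n}}]$, and let $S$ be the set of monic polynomials of $R$ with nonzero constant term that are prime elements of $D$ (so every prime element of $D$ is associated to exactly one element of $S$). Infinite product: for a nonzero nonunit $f$ of $D$ and nonnegative integers $k_p$ $(p\in S)$, one writes $f=u_f\prod_{p\in S}p^{k_p}$ if (1) for each $p\in S$, $p^{k_p}\mid f$ but $p^{k_p+1}\nmid f$ in $D$; and (2) whenever $g\in D$ is such that $p^{k_p}\mid g$ but $p^{k_p+1}\nmid g$ for each $p\in S$, then $gD\subseteq fD$. Here $u_f$ is the unit of $D$ such that $f=u_ff_1$ for a monic polynomial $f_1$ of $R$ with $f_1(0)\neq0$. If $T=\{p\in S\mid k_p\neq 0\}$, one also writes $f=u_f\prod_{p\in T}p^{k_p}$. *)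

(* Defs.v *)
From HB Require Import structures.
From mathcomp Require Import all_boot all_order all_algebra all_field.
From mathcomp Require Import boolp classical_sets functions cardinality.

Set Implicit Arguments.
Unset Strict Implicit.
Unset Printing Implicit Defensive.

Import GRing.Theory.

Local Open Scope classical_set_scope.
Local Open Scope ring_scope.

(* An indeterminate X over Q together with compatible roots X^(1/2^n), living *)
(* in some field K: [Xroot X n] is X^(1/2^n), and being an indeterminate means *)
(* being transcendental. The rings R and D below depend, up to isomorphism,    *)
(* neither on K nor on the choice of roots; [dyadic_roots_exist] shows that    *)
(* such roots exist.                                                           *)
Record dyadic_roots (K : fieldType) := DyadicRoots {
  ratK : {rmorphism rat -> K};
  Xroot : nat -> K;
  Xroot_sqr : forall n, Xroot n.+1 ^+ 2 = Xroot n;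
  Xroot_transc : ~ algebraicOver ratK (Xroot 0)
}.

Section DyadicRings.
Variables (K : fieldType) (X : dyadic_roots K).

Definition evalX (n : nat) (p : {poly rat}) : K :=
  (map_poly (ratK X) p).[Xroot X n].

(* D is the union over n of the rings Q[Y, Y^-1] with Y = X^(1/2^n), whose     *)
(* elements are the p(Y) / Y^m with p a polynomial.                            *)
Definition laurent_at (n : nat) (f : K) : Prop :=
  exists (p : {poly rat}) (m : nat), f = evalX n p / Xroot X n ^+ m.

Definition in_D : {pred K} := [pred f | `[< exists n, laurent_at n f >]].

Lemma in_DP f : reflect (exists n, laurent_at n f) (f \in in_D).
Proof. exact: asboolP. Qed.

Lemma Xroot_neq0 n : Xroot X n != 0.
Proof.
have X0 : Xroot X 0 != 0.
  apply/eqP => X0; apply: (@Xroot_transc _ X).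
  by exists 'X; rewrite ?polyX_eq0 // map_polyX X0 /root hornerX.
elim: n => // n; apply: contra_neq => Xn.
by rewrite -Xroot_sqr Xn expr0n.
Qed.

Lemma Xroot_exp n k : Xroot X (n + k) ^+ (2 ^ k) = Xroot X n.
Proof.
elim: k => [|k IHk]; first by rewrite addn0.
by rewrite addnS expnS exprM Xroot_sqr.
Qed.

Lemma evalX_lift n k p : evalX n p = evalX (n + k) (p \Po 'X^(2 ^ k)).
Proof.
by rewrite /evalX map_comp_poly horner_comp map_polyXn hornerXn Xroot_exp.
Qed.

Lemma laurent_lift n k f : laurent_at n f -> laurent_at (n + k) f.
Proof.
case=> p [m ->]; exists (p \Po 'X^(2 ^ k)), (2 ^ k * m)%N.
by rewrite -evalX_lift exprM Xroot_exp.
Qed.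

Lemma laurent_common f g : f \in in_D -> g \in in_D ->
  exists n m p q,
    f = evalX n p / Xroot X n ^+ m /\ g = evalX n q / Xroot X n ^+ m.
Proof.
move=> /in_DP[n /(laurent_lift)lf] /in_DP[n' lg].
have [p [m ->]] := lf n'; move/(laurent_lift n): lg; rewrite addnC => -[q [l ->]].
have nz j : Xroot X (n + n') ^+ j != 0 by rewrite expf_neq0 ?Xroot_neq0.
exists (n + n')%N, (m + l)%N, (p * 'X^l), (q * 'X^m).
rewrite /evalX !rmorphM /= !map_polyXn !hornerM !hornerXn exprD; split.
  by rewrite -mulf_div divff // mulr1.
by rewrite [_ ^+ m * _]mulrC -mulf_div divff // mulr1.
Qed.

Fact in_D_subring : subring_closed in_D.
Proof.
split=> [|f g|f g]; first (apply/in_DP; exists 0%N, 1, 0%N).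
- by rewrite /evalX rmorph1 hornerC divr1.
- move=> /laurent_common/[apply] -[n [m [p [q [-> ->]]]]].
  apply/in_DP; exists n, (p - q), m.
  by rewrite /evalX rmorphB /= hornerD hornerN mulrBl.
- move=> /laurent_common/[apply] -[n [m [p [q [-> ->]]]]].
  apply/in_DP; exists n, (p * q), (m + m)%N.
  by rewrite /evalX rmorphM /= hornerM exprD mulf_div.
Qed.
HB.instance Definition _ := GRing.isSubringClosed.Build K in_D in_D_subring.

Definition dyadic_laurent := {f : K | f \in in_D}.
HB.instance Definition _ := SubType.on dyadic_laurent.
HB.instance Definition _ := Choice.on dyadic_laurent.
HB.instance Definition _ :=
  [SubChoice_isSubComNzRing of dyadic_laurent by <:].

Definition D_unit : {pred dyadic_laurent} :=
  [pred u | `[< exists v : dyadic_laurent, v * u = 1 >]].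

Definition D_inv (u : dyadic_laurent) : dyadic_laurent :=
  if pselect (exists v : dyadic_laurent, v * u = 1) is left uu
  then projT1 (cid uu) else u.

Fact D_mulVx : {in D_unit, left_inverse 1 D_inv *%R}.
Proof.
move=> u /asboolP uu; rewrite /D_inv; case: pselect => // {}uu.
by case: (cid uu).
Qed.

Fact D_unitPl u v : v * u = 1 -> D_unit u.
Proof. by move=> vu; apply/asboolP; exists v. Qed.

Fact D_inv_out : {in [predC D_unit], D_inv =1 id}.
Proof. by move=> u /asboolP uu; rewrite /D_inv; case: pselect. Qed.

HB.instance Definition _ :=
  GRing.ComNzRing_hasMulInverse.Build dyadic_laurent
    D_mulVx D_unitPl D_inv_out.

Fact D_integral : GRing.integral_domain_axiom dyadic_laurent.
Proof.
move=> f g /(congr1 val); rewrite rmorphM rmorph0 => /eqP.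
by rewrite mulf_eq0 -!(inj_eq val_inj) rmorph0.
Qed.
HB.instance Definition _ :=
  GRing.ComUnitRing_isIntegral.Build dyadic_laurent D_integral.

End DyadicRings.

Section Divisibility.
Variable A : comUnitRingType.
Implicit Types a b p : A.

Definition divides a b : Prop := exists c, b = a * c.

Definition prime_elt p : Prop :=
  [/\ p != 0, p \isn't a GRing.unit
    & forall a b, divides p (a * b) -> divides p a \/ divides p b].

Definition principal_ideal a : set A := range ( *%R a).

(* p^k exactly divides f *)
Definition exact_pow p (k : nat) f : Prop :=
  divides (p ^+ k) f /\ ~ divides (p ^+ k.+1) f.

End Divisibility.

Section InfiniteProduct.
Variables (K : fieldType) (X : dyadic_roots K).
Local Notation D := (dyadic_laurent X).

(* Monic elements of R = \bigcup_n Q[X^(1/2^n)] with nonzero constant term.    *)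
(* Passing from level n to level n + 1 substitutes 'X^2 for 'X, which changes  *)
(* neither the leading coefficient nor the constant one.                       *)
Definition monic_R (f : D) : Prop :=
  exists (n : nat) (p : {poly rat}),
    [/\ p \is monic, p`_0 != 0 & val f = evalX X n p].

Definition monic_primes : set D := [set p | monic_R p /\ prime_elt p].

Definition unit_part (f u : D) : Prop :=
  u \is a GRing.unit /\ exists2 f1 : D, monic_R f1 & f = u * f1.

(* f = u \prod_(p in S) p^(k p), where S = [monic_primes] *)
Definition is_inf_prod (f u : D) (k : monic_primes -> nat) : Prop :=
  [/\ unit_part f u,
      forall p : monic_primes, exact_pow (val p) (k p) f
    & forall g : D,
        (forall p : monic_primes, exact_pow (val p) (k p) g) ->
        principal_ideal g `<=` principal_ideal f].

End InfiniteProduct.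

Lemma dyadic_roots_exist : exists K : fieldType, inhabited (dyadic_roots K).
Proof.
pose F := {fraction {poly rat}}.
pose to_pair (x : F) := frac (repr x).
pose of_pair y : option F := omap (\pi_F)%qT (insub y).
have pairK : pcancel to_pair of_pair.
  by move=> x; rewrite /of_pair /to_pair valK /= reprK.
pose QX : countFieldType := HB.pack F (PCanIsCountable pairK).
have [K [emb _]] := countable_algebraic_closure QX.
have sqrtP (a : K) : exists b, b ^+ 2 = a.
  have [b] := @solve_monicpoly K 2 (fun i => a *+ (i == 0%N)) isT.
  rewrite !big_ord_recl big_ord0 /= mulr0n mul0r !addr0 mulr1 => bE.
  by exists b.
pose sqrtK a := projT1 (cid (sqrtP a)).
pose i : {rmorphism rat -> K} := emb \o (@FracField.tofrac {poly rat} \o polyC).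
exists K; constructor.
apply: (@DyadicRoots K i (fun n => iter n sqrtK (emb (FracField.tofrac 'X)))).
  by move=> n /=; rewrite /sqrtK; case: cid.
move=> [p p0] /=; rewrite /i map_poly_comp /= /root horner_map fmorph_eq0.
rewrite map_poly_comp horner_map /= tofrac_eq0.
by rewrite -/(comp_poly _ _) comp_polyXr (negPf p0).
Qed.

(* Main.v *)
Require Import Defs.
From mathcomp Require Import all_boot all_order all_algebra all_field.
From mathcomp Require Import boolp classical_sets cardinality.
From mathcomp Require Import ring zify.

(* D is an increasing union of Laurent polynomial rings, each step             *)
(* substituting X^2 for X. An irreducible q, prime to X, stays irreducible     *)
(* under one step unless X is a square modulo q, and (as in Capelli's theorem) *)
(* it then stays irreducible forever if moreover -1 is a square modulo q, or   *)
(* is a square modulo no irreducible divisor of any q(X^(2^j)). Such stable    *)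
(* polynomials give primes of D. Unless q has a stable irreducible divisor     *)
(* at some level, there is an h such that X is a square modulo all irreducible *)
(* divisors k of all h(X^(2^j)). These k have degree at most deg h, a leading  *)
(* coefficient dividing that of h by Gauss' lemma and bounded roots, hence are *)
(* finitely many; yet the 2^j-th roots of a root of h are roots of them, for   *)
(* all j, which is absurd. So every nonzero nonunit of D has a prime divisor.  *)
(* As irreducible polynomials remain squarefree in D, the multiplicities of    *)
(* the primes then determine divisibility.                                     *)

Set Implicit Arguments.
Unset Strict Implicit.
Unset Printing Implicit Defensive.

Import Order.TTheory GRing.Theory Num.Theory.

Local Open Scope ring_scope.

(** Every element of D is a unit times some [polyD n q], that is q(X^(1/2^n)) with [q] in Q[X];
    going one level deeper replaces q by q(X^2). For p coprime to X, divisibility of [polyD n q] by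
    [polyD n p] in D is plain divisibility in Q[X] ([divides_polyD_coprime]), so a polynomial
    coprime to X that stays irreducible at all deeper levels is prime in D ([stable_prime]).

    Two facts carry the proof. By [stable_descendant], an irreducible q coprime to X acquires a
    stable divisor at some level, hence has a prime divisor in D, although it may keep splitting
    forever. By [irreducible_squarefree], it never acquires a square factor, because it is
    separable. Each prime of D thus has multiplicity 0 or 1 in q, and multiplicities in a nonzero
    polynomial are finite. Induction on irreducible factors then shows that f divides g once every
    prime power dividing f divides g ([divides_of_prime_pows]). This is the minimality clause of the
    infinite product, while exactness of the powers alone determines the exponents. *)

Section Pullback.
Variable F : fieldType.
Implicit Types p q h k s : {poly F}.

(** * Substitution of powers of X, and irreducible factors *)

Lemma size_comp_polyXn p n : p != 0 ->
  size (p \Po 'X^(n.+1)) = ((size p).-1 * n.+1).+1.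
Proof.
move=> p0; have := size_comp_poly p 'X^(n.+1); rewrite size_polyXn /= => <-.
by rewrite prednK // size_poly_gt0 comp_poly_eq0 // size_polyXn.
Qed.

Lemma comp_polyXn_eq0 p n : (p \Po 'X^(n.+1) == 0) = (p == 0).
Proof. by rewrite comp_poly_eq0 // size_polyXn. Qed.

Lemma dvdp_comp_polyXn p q n : (p \Po 'X^(n.+1) %| q \Po 'X^(n.+1)) = (p %| q).
Proof.
apply/idP/idP; last exact: dvdp_comp_poly.
have [->|p0] := eqVneq p 0; first by rewrite comp_poly0 !dvd0p comp_polyXn_eq0.
rewrite {1}(divp_eq q p) comp_polyD comp_polyM dvdp_addr ?dvdp_mull // /dvdp.
have [//|r0] := eqVneq (q %% p) 0.
move/dvdp_leq; rewrite comp_polyXn_eq0 r0 => /(_ isT).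
rewrite !size_comp_polyXn // ltnS leq_mul2r /= => le_pr.
have := ltn_modpN0 q p0; have := size_poly_gt0 (q %% p); rewrite r0.
by move: le_pr; move: (size (q %% p)) (size p); lia.
Qed.

Lemma comp_polyX2_exp p n : p \Po 'X^(2 ^ n.+1) = (p \Po 'X^2) \Po 'X^(2 ^ n).
Proof. by rewrite -comp_polyA comp_Xn_poly -exprM -expnSr. Qed.

Lemma comp_polyX2_expS p n : p \Po 'X^(2 ^ n.+1) = (p \Po 'X^(2 ^ n)) \Po 'X^2.
Proof. by rewrite -comp_polyA comp_Xn_poly -exprM -expnS. Qed.

Lemma comp_polyXexp_exp p m n :
  p \Po 'X^(2 ^ (m + n)) = (p \Po 'X^(2 ^ m)) \Po 'X^(2 ^ n).
Proof. by rewrite -comp_polyA comp_Xn_poly -exprM -expnD addnC. Qed.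

Lemma irreducible_dvdM q h k : irreducible_poly q ->
  (q %| h * k) = (q %| h) || (q %| k).
Proof.
move=> qi; apply/idP/orP => [|[]]; last 2 first.
- exact: dvdp_mulr.
- exact: dvdp_mull.
have [qh _|/negP] := boolP (q %| h); first by left.
move=> /negP; rewrite -(irreducible_poly_coprime _ qi) => /Gauss_dvdpr->.
by right.
Qed.

Lemma irreducible_dvdX q h n : irreducible_poly q -> q %| h ^+ n -> q %| h.
Proof.
move=> qi; elim: n => [|n IH]; last first.
  by rewrite exprS irreducible_dvdM // => /orP[].
by rewrite expr0 dvdp1 => /eqP q1; case: qi; rewrite q1.
Qed.

(** Splitting a reducible polynomial hands [P] down to a proper factor, and constants cannot receive
    it. With [P] a divisibility or a vanishing condition, this selects an irreducible factor
    responsible for it. *)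
Lemma irreducible_factor_with (P : {poly F} -> Prop) :
    (forall c, c != 0 -> ~ P c%:P) ->
    (forall h k, P (h * k) -> P h \/ P k) ->
  forall p, p != 0 -> P p -> exists2 q, irreducible_poly q & q %| p /\ P q.
Proof.
move=> PC PM p; have [n] := ubnP (size p); elim: n p => // n IH p.
rewrite ltnS => sp p0 Pp.
have [pi|pni] := pselect (irreducible_poly p); first by exists p.
have p1 : (1 < size p)%N.
  rewrite ltnNge; apply/negP => /size1_polyC pc; rewrite pc in p0 Pp.
  by apply: (PC _ _ Pp); rewrite -polyC_eq0.
have [h] : exists h, [/\ size h != 1, h %| p & ~ h %= p].
  apply: contrapT => nex; apply: pni; split=> // h h1 hp.
  by apply: contrapT => nhp; apply: nex; exists h; split=> //; apply/negP.
case=> h1 /dvdpP[k pE] nhp.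
have k0 : k != 0 by apply: contra_neq p0 => k0; rewrite pE k0 mul0r.
have h0 : h != 0 by apply: contra_neq p0 => h0; rewrite pE h0 mulr0.
have sk : (1 < size k)%N.
  rewrite ltnNge; apply/negP => /size1_polyC kc; apply: nhp.
  by rewrite pE kc mul_polyC eqp_sym eqp_scale // -polyC_eq0 -kc.
have sh : (1 < size h)%N by rewrite ltn_neqAle eq_sym h1 size_poly_gt0.
have spE : size p = (size k + size h).-1 by rewrite pE size_mul.
have lek : (size k < n)%N by lia.
have leh : (size h < n)%N by lia.
move: Pp; rewrite pE => /PM[/(IH _ lek k0)|/(IH _ leh h0)] [q qi [qd Pq]].
  by exists q => //; split=> //; rewrite dvdp_mulr.
by exists q => //; split=> //; rewrite dvdp_mull.
Qed.

Lemma irreducible_factor p : (1 < size p)%N ->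
  exists2 q, irreducible_poly q & q %| p.
Proof.
move=> p1; have p0 : p != 0 by rewrite -size_poly_gt0 ltnW.
have [|h k|q qi [qp _]] :=
  @irreducible_factor_with (fun h => 1 < size h)%N _ _ _ p0 p1;
  last by exists q.
  by move=> c _; rewrite size_polyC; case: (_ != _).
have [->|h0] := eqVneq h 0; first by rewrite mul0r size_poly0.
have [->|k0] := eqVneq k 0; first by rewrite mulr0 size_poly0.
rewrite size_mul // => hk; apply/orP; move: hk; apply: contraTT.
by rewrite negb_or -!leqNgt => /andP[hk1 kk1]; rewrite -subn1 leq_subLR leq_add.
Qed.

Lemma poly_factor_ind (P : {poly F} -> Prop) :
    (forall c, c != 0 -> P c%:P) ->
    (forall q p, irreducible_poly q -> p != 0 -> P p -> P (q * p)) ->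
  forall p, p != 0 -> P p.
Proof.
move=> PC PM p; have [n] := ubnP (size p); elim: n p => // n IH p.
rewrite ltnS => sp p0; have [/size1_polyC pE|p1] := leqP (size p) 1.
  by rewrite pE; apply: PC; rewrite -polyC_eq0 -pE.
have [q qi /dvdpP[r pE]] := irreducible_factor p1.
have r0 : r != 0 by apply: contra_neq p0 => r0; rewrite pE r0 mul0r.
rewrite pE mulrC; apply: PM => //; apply: IH => //; apply: leq_trans sp.
rewrite pE size_mul ?(irredp_neq0 qi) //; have := qi.1.
by move: (size r) (size q); lia.
Qed.

Lemma coprimepX_comp q n : coprimep q 'X -> coprimep (q \Po 'X^(n.+1)) 'X.
Proof.
by rewrite !coprimepX /root horner_comp hornerXn expr0n.
Qed.

(** * Squares modulo a polynomial, and the norm to F[X^2] *)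

Definition square_mod q a := exists s, q %| s ^+ 2 - a.

Lemma square_mod_dvd q k a : k %| q -> square_mod q a -> square_mod k a.
Proof. by move=> kq [s qs]; exists s; apply: dvdp_trans qs. Qed.

Lemma square_mod_comp q a n :
  square_mod q a -> square_mod (q \Po 'X^n) (a \Po 'X^n).
Proof.
case=> s qs; exists (s \Po 'X^n).
by rewrite -rmorphXn -comp_polyB dvdp_comp_poly.
Qed.

Lemma square_modM q a b :
  square_mod q a -> square_mod q b -> square_mod q (a * b).
Proof.
move=> [s qs] [t qt]; exists (s * t).
have -> : (s * t) ^+ 2 - a * b = t ^+ 2 * (s ^+ 2 - a) + a * (t ^+ 2 - b).
  by ring.
by rewrite dvdp_add // dvdp_mull.
Qed.

Lemma square_mod_div q a b : coprimep q b ->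
  square_mod q (a * b ^+ 2) -> square_mod q a.
Proof.
move=> /Bezout_eq1_coprimepP[[u v] /= uv] [s qs]; exists (s * v).
have -> : (s * v) ^+ 2 - a = v ^+ 2 * (s ^+ 2 - a * b ^+ 2) +
   a * ((v * b + 1) * (- u)) * q.
  have -> : v * b = 1 - u * q by rewrite -uv addrC addKr.
  have vb : v ^+ 2 * (a * b ^+ 2) = a * (1 - u * q) ^+ 2.
    by rewrite -uv [X in X - _]addrC addrK; ring.
  by rewrite mulrBr vb; ring.
by rewrite dvdp_add // dvdp_mull.
Qed.

Definition conjX p := p \Po - 'X.

Lemma conjXK : involutive conjX.
Proof.
move=> p; rewrite /conjX -comp_polyA linearN /= comp_polyX opprK.
exact: comp_polyXr.
Qed.

Lemma conjX_comp p : conjX (p \Po 'X^2) = p \Po 'X^2.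
Proof. by rewrite /conjX -comp_polyA comp_Xn_poly sqrrN. Qed.

Lemma size_conjX p : size (conjX p) = size p.
Proof. by rewrite size_comp_poly2 // size_polyN size_polyX. Qed.

(* The norm from F[X] to F[X^2], read as a polynomial in X^2. *)
Definition normX p := even_poly p ^+ 2 - 'X * odd_poly p ^+ 2.

Lemma normXE p : normX p \Po 'X^2 = p * conjX p.
Proof.
have -> : conjX p = even_poly p \Po 'X^2 - (odd_poly p \Po 'X^2) * 'X.
  rewrite -{1}(poly_even_odd p) /conjX comp_polyD comp_polyM comp_polyX.
  by rewrite -!comp_polyA comp_Xn_poly sqrrN mulrN.
rewrite -[X in X * _]poly_even_odd /normX comp_polyB (comp_polyM 'X) comp_polyX.
by rewrite !rmorphXn /=; ring.
Qed.

Lemma size_normX p : size (normX p) = size p.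
Proof.
have [->|p0] := eqVneq p 0.
  by rewrite /normX even_polyC odd_polyC expr0n mulr0 subr0.
have cp0 : conjX p != 0 by rewrite -size_poly_gt0 size_conjX size_poly_gt0.
have n0 : normX p != 0 by rewrite -(comp_polyXn_eq0 _ 1) normXE mulf_neq0.
have := congr1 (fun u : {poly F} => size u) (normXE p).
rewrite size_comp_polyXn // size_mul // size_conjX.
move: n0 p0; rewrite -!size_poly_gt0.
by move: (size (normX p)) (size p); lia.
Qed.

(** If h k = q(X^2), norms give N(h) N(k) = q^2, so q divides N(h) = e^2 - X o^2, where e and o are
    the even and odd parts of the nonconstant h. If q divides o, it divides e too, and q(X^2)
    divides h; otherwise e/o is a square root of X modulo q. *)
Lemma irreducible_comp_polyX2 q : irreducible_poly q -> ~ square_mod q 'X ->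
  irreducible_poly (q \Po 'X^2).
Proof.
move=> qi nsq; have q0 := irredp_neq0 qi; split=> [|h h1 hq].
  rewrite size_comp_polyXn // ltnS muln2 double_gt0.
  by case: qi => + _; case: (size q) => [|[]].
rewrite /eqp hq /=.
have /dvdpP[k hk] := hq.
have NN : normX h * normX k = q ^+ 2.
  apply/eqP; rewrite -subr_eq0 -(comp_polyXn_eq0 _ 1) comp_polyB subr_eq0.
  rewrite comp_polyM !normXE rmorphXn /= expr2 -{2}(conjX_comp q) hk.
  by rewrite /conjX comp_polyM; apply/eqP; ring.
have qN : q %| normX h.
  have [//|nqN] := boolP (q %| normX h).
  have: normX h %| q ^+ 2 by rewrite -NN dvdp_mulr.
  rewrite -(mulr1 (q ^+ 2)) Gauss_dvdpr ?dvdp1 ?size_normX ?(negPf h1) //.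
  by rewrite coprimep_sym coprimep_expl // irreducible_poly_coprime.
have [qo|nqo] := boolP (q %| odd_poly h).
  have qe : q %| even_poly h.
    apply: (@irreducible_dvdX _ _ 2) => //.
    rewrite -(subrK ('X * odd_poly h ^+ 2) (_ ^+ 2)) dvdp_add //.
    by rewrite expr2 !dvdp_mull.
  by rewrite -(poly_even_odd h) dvdp_add ?dvdp_mulr // dvdp_comp_poly.
case: nsq; apply: (@square_mod_div _ _ (odd_poly h)).
  by rewrite irreducible_poly_coprime.
by exists (even_poly h).
Qed.

(** Take norms to F[X^2] in s^2 = X: the norm of X is -X^2, so N(s) is a square root of -X modulo
    q. *)
Lemma square_mod_normX q : square_mod (q \Po 'X^2) 'X -> square_mod q (- 'X).
Proof.
case=> s qs; exists (normX s); rewrite -(dvdp_comp_polyXn _ _ 1).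
have qs' : q \Po 'X^2 %| conjX s ^+ 2 + 'X.
  have := dvdp_comp_poly (- 'X) qs.
  by rewrite -/(conjX _) conjX_comp comp_polyB rmorphXn /= comp_polyX opprK.
rewrite comp_polyB !rmorphN /= rmorphXn /= normXE comp_polyX opprK.
have -> : (s * conjX s) ^+ 2 + 'X^2 =
    conjX s ^+ 2 * (s ^+ 2 - 'X) + 'X * (conjX s ^+ 2 + 'X).
  by ring.
by rewrite dvdp_add // dvdp_mull.
Qed.

Lemma square_modN1 q : coprimep q 'X ->
  square_mod (q \Po 'X^2) 'X -> square_mod (q \Po 'X^2) (- 1).
Proof.
move=> qX /square_mod_normX/(square_mod_comp 2) sN.
apply: (@square_mod_div _ _ 'X); first exact: coprimepX_comp.
by rewrite mulN1r -{2}(comp_polyX 'X^2) -rmorphN.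
Qed.

(** * Polynomials that remain irreducible at every level *)

Definition stable q := forall j, irreducible_poly (q \Po 'X^(2 ^ j)).

Lemma stable_ind (P : {poly F} -> Prop) :
    (forall q, P q -> irreducible_poly q /\ ~ square_mod q 'X) ->
    (forall q, P q -> P (q \Po 'X^2)) ->
  forall q, P q -> stable q.
Proof.
move=> Pi Pc q Pq j; elim: j q Pq => [|j IH] q Pq.
  by rewrite comp_polyXr; case: (Pi q Pq).
by rewrite comp_polyX2_exp; apply: IH; apply: Pc.
Qed.

(** The hypotheses pass from q to q(X^2): a square root of X modulo q(X^2) would make -X, hence its
    product with -1, a square modulo q. *)
Lemma stable_of_sqrtN1 q : irreducible_poly q -> square_mod q (- 1) ->
  ~ square_mod q 'X -> stable q.
Proof.
pose P q := [/\ irreducible_poly q, square_mod q (- 1) & ~ square_mod q 'X].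
move=> qi qN nq; apply: (@stable_ind P) => // [{}q []//|{}q [{}qi {}qN {}nq]].
split; first exact: irreducible_comp_polyX2.
  by have := square_mod_comp 2 qN; rewrite rmorphN rmorph1.
by move=> /square_mod_normX/(square_modM qN); rewrite mulN1r opprK.
Qed.

Lemma exp2_pred n : ((2 ^ n).-1.+1 = 2 ^ n)%N.
Proof. by rewrite prednK // expn_gt0. Qed.

Lemma stable_irreducible h : stable h -> irreducible_poly h.
Proof. by move/(_ 0); rewrite comp_polyXr. Qed.

Lemma irreducible_ndvdXn h m : irreducible_poly h -> coprimep h 'X ->
  ~~ (h %| 'X^m).
Proof.
move=> hi hX; apply/negP => /(irreducible_dvdX hi).
by apply/negP; rewrite -irreducible_poly_coprime.
Qed.

Lemma coprimepX_coef0 p : coprimep p 'X = (p`_0 != 0).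
Proof. by rewrite coprimepX /root horner_coef0. Qed.

Lemma stableZ (c : F) h : c != 0 -> stable h -> stable (c *: h).
Proof.
move=> c0 hs j; have [s1 hd] := hs j; rewrite comp_polyZ.
split; first by rewrite size_scale.
move=> q q1; rewrite dvdpZr // => /(hd _ q1) /eqp_trans; apply.
by rewrite eqp_sym eqp_scale.
Qed.

(** * Degrees of descendants, the irreducible divisors of the q(X^(2^j)) *)

Hypothesis F2 : 2%:R != 0 :> F.

(** Since X^2 = s(X^2)^2 modulo q(X^2), k divides s(X^2) - X or s(X^2) + X. Were k not coprime to
    k(-X), it would divide both, hence 2X. So k(X) k(-X) = N(k)(X^2) divides q(X^2), and degrees can
    be compared. *)
Lemma size_dvd_comp_polyX2 q k : coprimep q 'X -> square_mod q 'X ->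
  irreducible_poly k -> k %| q \Po 'X^2 -> (size k <= size q)%N.
Proof.
move=> qX [s qs] ki kq; have [q0|q0] := eqVneq q 0.
  by move: qX; rewrite q0 coprime0p -size_poly_eq1 size_polyX.
have kX : coprimep k 'X by apply: coprimep_dvdr kq _; apply: coprimepX_comp.
have k'q : conjX k %| q \Po 'X^2 by rewrite -conjX_comp dvdp_comp_poly.
have kk' : coprimep k (conjX k).
  rewrite irreducible_poly_coprime //; apply/negP => kk'.
  have := dvdp_trans kq (dvdp_comp_poly 'X^2 qs).
  rewrite comp_polyB rmorphXn /= comp_polyX subr_sqr irreducible_dvdM //.
  have kk : conjX k %| k by rewrite -{2}(conjXK k) dvdp_comp_poly.
  have aux e : k %| s \Po 'X^2 + e *: 'X -> k %| s \Po 'X^2 - e *: 'X.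
    move=> /(dvdp_comp_poly (- 'X)); rewrite -!/(conjX _) => /(dvdp_trans kk').
    rewrite /conjX comp_polyD -/(conjX _) conjX_comp comp_polyZ comp_polyX.
    by rewrite scalerN.
  have aux2 : k %| s \Po 'X^2 - 'X -> k %| s \Po 'X^2 + 'X -> False.
    move=> k1 k2; have := dvdp_sub k2 k1.
    have -> : s \Po 'X^2 + 'X - (s \Po 'X^2 - 'X) = 2%:R *: 'X.
      by rewrite scaler_nat; ring.
    rewrite dvdpZr // => /(coprimep_dvdl)/(_ kX).
    by rewrite coprimepp; case: ki => + _; case: (size k) => [|[]].
  case/orP=> hk; apply: aux2 => //.
    by have := @aux (-1); rewrite scaleNr scale1r opprK; apply.
  by have := @aux 1; rewrite scale1r; apply.
have: k * conjX k %| q \Po 'X^2 by rewrite Gauss_dvdp // kq.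
move/dvdp_leq; rewrite comp_polyXn_eq0 => /(_ q0).
rewrite size_comp_polyXn // -normXE size_comp_polyXn -?size_poly_gt0 size_normX;
  last by case: ki => /ltnW.
rewrite ltnS leq_mul2r /=.
case: (size k) => // n; case E: (size q) => [|m] //=.
by move/eqP: E; rewrite size_poly_eq0 (negPf q0).
Qed.

Lemma irreducible_factor_compX2 q k : q != 0 -> irreducible_poly k ->
  k %| q \Po 'X^2 -> exists2 p, irreducible_poly p & p %| q /\ k %| p \Po 'X^2.
Proof.
move=> q0 ki.
apply: (@irreducible_factor_with (fun q => k %| q \Po 'X^2)) => //.
  move=> c c0; rewrite comp_polyC -alg_polyC dvdpZr // dvdp1 => /eqP k1.
  by case: ki; rewrite k1.
by move=> h h'; rewrite comp_polyM irreducible_dvdM // => /orP.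
Qed.

End Pullback.

Lemma irreducible_factor_root (F K : fieldType) (i : {rmorphism F -> K})
    (p : {poly F}) (z : K) : p != 0 -> root (map_poly i p) z ->
  exists2 q, irreducible_poly q & q %| p /\ root (map_poly i q) z.
Proof.
apply: (irreducible_factor_with (P := fun q => root (map_poly i q) z)).
  by move=> c c0; rewrite map_polyC /= rootC fmorph_eq0 (negPf c0).
by move=> h k; rewrite rmorphM rootM => /orP.
Qed.

(** A descendant at step j + 1 divides p(X^2) for a descendant p at step j; as X is a square modulo
    p, the degree does not grow. *)
Lemma size_descendant (F : fieldType) (h : {poly F}) :
    2%:R != 0 :> F -> irreducible_poly h -> coprimep h 'X ->
    (forall j k, irreducible_poly k -> k %| h \Po 'X^(2 ^ j) ->
      square_mod k 'X) ->
  forall j k, irreducible_poly k -> k %| h \Po 'X^(2 ^ j) ->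
  (size k <= size h)%N.
Proof.
move=> F2 hi hX hsq; elim=> [|j IH] k ki.
  by rewrite comp_polyXr => /dvdp_leq; apply; apply: irredp_neq0.
have nz i : h \Po 'X^(2 ^ i) != 0.
  by rewrite -(prednK (expn_gt0 2 i)) comp_polyXn_eq0 irredp_neq0.
rewrite comp_polyX2_expS => /(irreducible_factor_compX2 (nz j) ki)[].
move=> p pi [ph kp].
apply: leq_trans (IH _ pi ph); apply: size_dvd_comp_polyX2 kp => //;
  last exact: hsq ph.
apply: coprimep_dvdr ph _; rewrite -(prednK (expn_gt0 2 j)).
exact: coprimepX_comp.
Qed.

(** * Finiteness of descendants of bounded degree, and stable divisors *)

Lemma norm_coef_prod_XsubC (R : numDomainType) (rs : seq R) (M : R) i :
    0 <= M -> (forall r, r \in rs -> `|r| <= M) ->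
  `|(\prod_(r <- rs) ('X - r%:P))`_i| <= (1 + M) ^+ size rs.
Proof.
move=> M0; have M1 : 0 <= 1 + M by rewrite addr_ge0.
elim: rs i => [|r rs IH] i rM.
  by rewrite big_nil coef1 expr0; case: (i == _); rewrite ?normr1 ?normr0.
rewrite big_cons mulrBl coefB coefXM coefCM exprS mulrDl mul1r.
have {}IH j : `|(\prod_(r <- rs) ('X - r%:P))`_j| <= (1 + M) ^+ size rs.
  by apply: IH => x xrs; apply: rM; rewrite inE xrs orbT.
apply: le_trans (ler_normB _ _) _; apply: lerD.
  by case: eqP => // _; rewrite normr0 exprn_ge0.
by rewrite normrM ler_pM ?normr_ge0 // rM // mem_head.
Qed.

Lemma norm_coef_le_roots (C : numClosedFieldType) (p : {poly C}) (M : C) i :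
    0 <= M -> (forall r, root p r -> `|r| <= M) -> p != 0 ->
  `|p`_i| <= `|lead_coef p| * (1 + M) ^+ (size p).-1.
Proof.
move=> M0 rM p0; have [rs pE] := closed_field_poly_normal p.
have lp0 : lead_coef p != 0 by rewrite lead_coef_eq0.
have -> : (size p).-1 = size rs.
  by rewrite pE size_scale // size_prod_XsubC.
rewrite {1}pE coefZ normrM ler_wpM2l ?normr_ge0 //.
apply: norm_coef_prod_XsubC => // r rrs; apply: rM.
by rewrite pE rootZ // root_prod_XsubC.
Qed.

Lemma roots_bounded (C : numClosedFieldType) (p : {poly C}) : p != 0 ->
  exists2 M : C, 1 <= M & forall r, root p r -> `|r| <= M.
Proof.
move=> p0; have [rs pE] := closed_field_poly_normal p.
have s0 : forall s : seq C, 0 <= \sum_(r <- s) `|r|.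
  by move=> s; apply: sumr_ge0 => r _; apply: normr_ge0.
exists (1 + \sum_(r <- rs) `|r|); first by rewrite lerDl.
move=> r; rewrite pE rootZ ?lead_coef_eq0 // root_prod_XsubC => rrs.
rewrite (big_rem r rrs) /= addrCA lerDl addr_ge0 //.
Qed.

(** [P] is the product of all nonzero polynomials within the bounds, so their finiteness is
    expressed by one nonzero polynomial having all their roots. *)
Lemma bounded_int_polys (d B : nat) : exists2 P : {poly int}, P != 0 &
  forall p : {poly int}, p != 0 -> (size p <= d)%N ->
    (forall i, `|p`_i| <= B%:Z) -> exists r, P = p * r.
Proof.
(* A coefficient in [-B, B] is stored as its translate by B, in [0, 2B]. *)
pose pol (f : {ffun 'I_d -> 'I_(B + B).+1}) : {poly int} :=
  \sum_(i < d) ((f i)%:Z - B%:Z) *: 'X^i.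
exists (\prod_(f | pol f != 0) pol f); first exact/prodf_neq0.
move=> p p0 sp pB.
pose f := [ffun i : 'I_d => inord `|p`_i + B%:Z| : 'I_(B + B).+1].
have pf : pol f = p.
  rewrite -[RHS](_ : \poly_(i < d) p`_i = p); last first.
    apply/polyP => i; rewrite coef_poly; case: ltnP => // di.
    by rewrite nth_default // (leq_trans sp).
  rewrite poly_def; apply: eq_bigr => i _; rewrite ffunE inordK.
    by congr (_ *: _); have := pB i; lia.
  by have := pB i; lia.
rewrite (bigD1 f) ?pf //=.
by exists (\prod_(g | (pol g != 0) && (g != f)) pol g).
Qed.

Local Notation ZtoQ := (map_poly (intr : int -> rat)).
Local Notation ZtoC := (map_poly (intr : int -> algC)).
Local Notation QtoC := (map_poly (ratr : rat -> algC)).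

Lemma QtoC_int (p : {poly int}) : QtoC (ZtoQ p) = ZtoC p.
Proof.
apply/polyP => i.
by rewrite !(coef_map_id0, ratr_int, raddf0) ?coef_map //= ratr_int.
Qed.

(** By Gauss' lemma k is, up to a scalar, an integer divisor p of hZ(X^(2^j)). The leading
    coefficient of p divides that of hZ, and the 2^j-th powers of its roots are roots of hZ, so its
    coefficients are bounded independently of j. *)
Lemma descendants_bounded (h : {poly rat}) d : h != 0 ->
  exists2 P : {poly int}, P != 0 & forall j k, irreducible_poly k ->
    k %| h \Po 'X^(2 ^ j) -> (size k <= d)%N ->
    forall z, root (QtoC k) z -> root (ZtoC P) z.
Proof.
move=> h0; have [hZ [a a0 hE]] := rat_poly_scale h.
have hZ0 : hZ != 0.
  by apply: contra_neq h0 => hZ0; rewrite hE hZ0 rmorph0 scaler0.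
have hC0 : ZtoC hZ != 0 by rewrite map_poly_eq0_id0 // intr_eq0 lead_coef_eq0.
have [M M1 hM] := roots_bounded hC0; have M0 : 0 <= M := le_trans ler01 M1.
pose B := Num.bound (`|(lead_coef hZ)%:~R| * (1 + M) ^+ d).
have [P P0 hP] := bounded_int_polys d B.
exists P => // j k ki; rewrite hE comp_polyZ dvdpZr ?invr_eq0 ?intr_eq0 //.
rewrite -(map_polyXn intr) -map_comp_poly.
move=> /dvdpP_rat_int[p [b b0 kE] [r hZE]].
have hZ'0 : hZ \Po 'X^(2 ^ j) != 0.
  by rewrite comp_poly_eq0 // size_polyXn ltnS expn_gt0.
have p0 : p != 0 by apply: contra_neq hZ'0 => p0; rewrite hZE p0 mul0r.
have r0 : r != 0 by apply: contra_neq hZ'0 => r0; rewrite hZE r0 mulr0.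
rewrite kE size_scale // size_rat_int_poly => sp z.
rewrite linearZ /= QtoC_int rootZ ?fmorph_eq0 // => pz.
have pC0 : ZtoC p != 0 by rewrite map_poly_eq0_id0 // intr_eq0 lead_coef_eq0.
have [|s ->] := hP p p0 sp _; last by rewrite rmorphM rootM pz.
have lp : lead_coef (ZtoC p) = (lead_coef p)%:~R.
  by rewrite lead_coef_map_inj //; apply: intr_inj.
move=> i; rewrite -(ler_int algC) intr_norm.
have -> : (p`_i)%:~R = (ZtoC p)`_i :> algC by rewrite coef_map.
have pM x : root (ZtoC p) x -> `|x| <= M.
  move=> px; have : `|x ^+ (2 ^ j)| <= M.
    apply: hM; rewrite /root -hornerXn -(map_polyXn intr) -horner_comp.
    by rewrite -map_comp_poly hZE -/(root _ x) rmorphM rootM px.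
  (* Here M >= 1 matters: |x| > M >= 1 would give |x|^(2^j) >= |x| > M. *)
  apply: contraTT; rewrite normrX -!real_ltNge ?ger0_real ?exprn_ge0 //.
  move=> Mx; apply: (lt_le_trans Mx); rewrite ler_eXnr ?expn_gt0 //.
  exact: ltW (le_lt_trans M1 Mx).
apply: le_trans (norm_coef_le_roots i M0 pM pC0) _; rewrite lp.
apply/ltW; apply: le_lt_trans (archi_boundP _); last first.
  by rewrite mulr_ge0 ?normr_ge0 ?exprn_ge0 ?addr_ge0.
apply: ler_pM; rewrite ?normr_ge0 ?exprn_ge0 ?addr_ge0 //.
  rewrite -!intr_norm ler_int.
  have := congr1 (fun u : {poly int} => `|lead_coef u|) hZE.
  rewrite lead_coef_comp ?size_polyXn ?ltnS ?expn_gt0 // lead_coefXn expr1n.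
  rewrite mulr1 lead_coefM normrM => ->; rewrite ler_peMr ?normr_ge0 //.
  by rewrite -gtz0_ge1 normr_gt0 lead_coef_eq0.
rewrite ler_weXn2l ?lerDl //.
rewrite (size_map_inj_poly (@intr_inj _)) //.
by apply: leq_trans sp; apply: leq_pred.
Qed.

(** Otherwise all descendants have bounded degree, so for every j all 2^j-th roots of a root alpha
    of h are roots of a single P. Taking j = [size (ZtoC P)] yields too many of them. *)
Lemma not_all_descendants_square (h : {poly rat}) :
    irreducible_poly h -> coprimep h 'X ->
  ~ (forall j k, irreducible_poly k -> k %| h \Po 'X^(2 ^ j) ->
      square_mod k 'X).
Proof.
move=> hi hX hsq; have h0 := irredp_neq0 hi.
have rat2 : 2%:R != 0 :> rat by rewrite pnatr_eq0.
have hsize := size_descendant rat2 hi hX hsq.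
have [P P0 hP] := descendants_bounded (size h) h0.
have PC0 : ZtoC P != 0 by rewrite map_poly_eq0_id0 // intr_eq0 lead_coef_eq0.
have [|alpha ha] := closed_rootP (QtoC h) _.
  by rewrite size_map_poly; case: hi; case: (size h) => [|[]].
have a0 : alpha != 0.
  apply: contraTneq ha => ->; rewrite /root horner_coef0 coef_map fmorph_eq0.
  by rewrite -horner_coef0 -/(root h 0) -coprimepX.
have rootP' j z : z ^+ (2 ^ j) = alpha -> root (ZtoC P) z.
  move=> za; have: root (QtoC (h \Po 'X^(2 ^ j))) z.
    by rewrite map_comp_poly map_polyXn /root horner_comp hornerXn za.
  case/irreducible_factor_root => [|k ki [kh kz]].
    by rewrite comp_poly_eq0 // size_polyXn ltnS expn_gt0.
  exact: hP ki kh (hsize _ _ ki kh) z kz.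
pose N := (2 ^ size (ZtoC P))%N; have N0 : (0 < N)%N by rewrite expn_gt0.
have [w wN] := C_prim_root_exists N0.
pose rs := [seq N.-root alpha * w ^+ i | i <- iota 0 N].
have : (size rs < size (ZtoC P))%N.
  apply: max_poly_roots => //.
    apply/allP => _ /mapP[i _ ->]; apply: (rootP' (size (ZtoC P))).
    rewrite exprMn rootCK // -exprM mulnC exprM (prim_expr_order wN).
    by rewrite expr1n mulr1.
  rewrite map_inj_in_uniq ?iota_uniq // => i i'.
  rewrite !mem_iota /= add0n => iN i'N.
  move/mulfI; rewrite rootC_eq0 // a0 => /(_ isT) /eqP.
  by rewrite (eq_prim_root_expr wN) !modn_small // => /eqP.
by rewrite size_map size_iota ltnNge ltnW // ltn_expl.
Qed.

Lemma stable_descendant (q : {poly rat}) : irreducible_poly q ->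
  coprimep q 'X -> exists j h, h %| q \Po 'X^(2 ^ j) /\ stable h.
Proof.
move=> qi qX; apply: contrapT => nst.
have desc j h : irreducible_poly h -> h %| q \Po 'X^(2 ^ j) -> ~ stable h.
  by move=> hi hq hs; apply: nst; exists j, h.
have comp j h i k : h %| q \Po 'X^(2 ^ j) -> k %| h \Po 'X^(2 ^ i) ->
    k %| q \Po 'X^(2 ^ (j + i)).
  move=> hq kh; apply: dvdp_trans kh _.
  by rewrite comp_polyXexp_exp dvdp_comp_poly.
have cop j h : h %| q \Po 'X^(2 ^ j) -> coprimep h 'X.
  move=> hq; apply: coprimep_dvdr hq _.
  by rewrite -(prednK (expn_gt0 2 j)); apply: coprimepX_comp.
have [[j [h [hi hq hN]]]|noN] := pselect (exists j h,
  [/\ irreducible_poly h, h %| q \Po 'X^(2 ^ j) & square_mod h (- 1)]).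
  (* Since -1 is still a square modulo every descendant of h, a descendant modulo which X is not a
     square is stable. *)
  apply: (not_all_descendants_square hi (cop _ _ hq)) => i k ki kh.
  apply: contrapT => nsq; apply: (desc (j + i) k) => //; first exact: comp kh.
  apply: stable_of_sqrtN1 => //; apply: square_mod_dvd kh _.
  by have := square_mod_comp (2 ^ i) hN; rewrite rmorphN rmorph1.
(* Now -1 is a square modulo no descendant of q. By [square_modN1], if X is not a square modulo a
   descendant h, it is not one modulo h(X^2) either. *)
apply: (not_all_descendants_square qi qX) => j h hi hq.
apply: contrapT => nsq; apply: (desc j h) => //.
pose P h := [/\ irreducible_poly h, exists j, h %| q \Po 'X^(2 ^ j)
  & ~ square_mod h 'X].
apply: (@stable_ind _ P) => [{}h []//|{j hi hq nsq}h [hi [j hq] nsq]|];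
  last by split=> //; exists j.
have h2i := irreducible_comp_polyX2 hi nsq.
have h2q : h \Po 'X^2 %| q \Po 'X^(2 ^ j.+1).
  by rewrite comp_polyX2_expS dvdp_comp_poly.
split=> //; first by exists j.+1.
move=> sq; apply: noN; exists j.+1, (h \Po 'X^2); split=> //.
exact: square_modN1 (cop _ _ hq) sq.
Qed.

(** * Divisibility and multiplicities of primes in an integral domain *)

Section Divides.
Variable A : idomainType.
Implicit Types a b c p q u : A.

Lemma divides_refl a : divides a a.
Proof. by exists 1; rewrite mulr1. Qed.

Lemma divides_trans a b c : divides a b -> divides b c -> divides a c.
Proof. by move=> [x ->] [y ->]; exists (x * y); rewrite mulrA. Qed.

Lemma divides_mull a b c : divides a c -> divides a (b * c).
Proof. by move=> [x ->]; exists (b * x); rewrite mulrCA. Qed.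

Lemma divides_mulr a b c : divides a b -> divides a (b * c).
Proof. by rewrite mulrC; apply: divides_mull. Qed.

Lemma dividesD a b c : divides a b -> divides a c -> divides a (b + c).
Proof. by move=> [x ->] [y ->]; exists (x + y); rewrite mulrDr. Qed.

Lemma divides_unitl u a : u \is a GRing.unit -> divides u a.
Proof. by move=> uU; exists (u^-1 * a); rewrite mulVKr. Qed.

Lemma divides_unit u a : u \is a GRing.unit -> divides a u ->
  a \is a GRing.unit.
Proof. by move=> + [x xE]; rewrite xE unitrM => /andP[]. Qed.

Lemma divides_unitMl u a b : u \is a GRing.unit ->
  divides (u * a) b <-> divides a b.
Proof.
move=> uU; split.
  by apply: divides_trans; apply/divides_mull/divides_refl.
by move=> [x ->]; exists (u^-1 * x); rewrite mulrACA mulrV // mul1r.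
Qed.

Lemma divides_unitMr u a b : u \is a GRing.unit ->
  divides a (u * b) <-> divides a b.
Proof.
move=> uU; split; last exact: divides_mull.
by move=> [x xE]; exists (u^-1 * x); rewrite mulrCA -xE mulKr.
Qed.

Lemma divides_mul2l a b c : a != 0 ->
  divides (a * b) (a * c) <-> divides b c.
Proof.
move=> a0; split=> -[x]; last by move=> ->; exists x; rewrite mulrA.
by rewrite -mulrA => /(mulfI a0) ->; exists x.
Qed.

Lemma divides_exp2l a m n : (m <= n)%N -> divides (a ^+ m) (a ^+ n).
Proof. by move=> mn; exists (a ^+ (n - m)); rewrite -exprD subnKC. Qed.

Lemma exact_pow_ge p k m a :
  exact_pow p k a -> divides (p ^+ m) a -> (m <= k)%N.
Proof.
move=> [_ nk] pm; rewrite leqNgt; apply/negP => km; apply: nk.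
exact: divides_trans (divides_exp2l _ km) pm.
Qed.

Lemma exact_pow_exists p a : (exists k, ~ divides (p ^+ k) a) ->
  exists k, exact_pow p k a.
Proof.
move=> ex; have {}ex : exists k, ~~ `[< divides (p ^+ k) a >].
  by case: ex => k nk; exists k; apply/asboolPn.
case: (ex_minnP ex) => -[|k] /asboolPn nk kmin.
  by case: nk; rewrite expr0; apply: divides_unitl; apply: unitr1.
exists k; split=> //; apply: contrapT => /asboolPn /kmin.
by rewrite ltnn.
Qed.

Lemma prime_pow_dividesM p q k a : prime_elt p -> ~ divides p q ->
  divides (p ^+ k) (q * a) -> divides (p ^+ k) a.
Proof.
move=> pp nq; have [p0 _ pM] := pp.
elim: k a => [|k IH] a.
  by move=> _; rewrite expr0; apply/divides_unitl/unitr1.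
move=> pk; have [//|[b aE]] : divides p q \/ divides p a.
  apply: pM; apply: divides_trans pk; rewrite exprS.
  exact/divides_mulr/divides_refl.
move: pk; rewrite aE exprS => -[c]; rewrite mulrCA -mulrA => /(mulfI p0) qb.
by apply/divides_mul2l => //; apply: IH; exists c.
Qed.

(** The shift [e] is the multiplicity of p in q, namely 1 or 0 according as p divides q or not. *)
Lemma squarefree_pow_dividesM p q : prime_elt p -> ~ divides (p ^+ 2) q ->
  exists e, forall k a, divides (p ^+ (e + k)) (q * a) <-> divides (p ^+ k) a.
Proof.
move=> pp nsq; have [p0 _ _] := pp.
have [[w qE]|npq] := pselect (divides p q); last first.
  exists 0%N => k a; rewrite add0n; split; last exact: divides_mull.
  exact: prime_pow_dividesM.
have npw : ~ divides p w.
  move=> [x xE]; apply: nsq; exists x.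
  by rewrite qE xE mulrA.
exists 1%N => k a; rewrite add1n exprS qE -mulrA divides_mul2l //.
by split; [apply: prime_pow_dividesM | apply: divides_mull].
Qed.

End Divides.

(** * Separability and square factors *)

Lemma irreducible_coprime_deriv (q : {poly rat}) :
  irreducible_poly q -> coprimep q q^`().
Proof.
move=> qi; rewrite irreducible_poly_coprime //.
have sq : (1 < size q)%N := qi.1.
have q'0 : q^`() != 0.
  apply/eqP => /polyP/(_ (size q).-2); rewrite coef0 coef_deriv.
  case E: (size q) sq => [|[|n]] //= _ /eqP; rewrite mulrn_eq0 /=.
  have := lead_coef_eq0 q; rewrite lead_coefE E /= => ->.
  by rewrite -size_poly_eq0 E.
apply/negP => /dvdp_leq; rewrite q'0 => /(_ isT); rewrite leqNgt.
by rewrite lt_size_deriv // irredp_neq0.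
Qed.

Lemma sqr_dvdp_comp_polyXn (F : numFieldType) (q p : {poly F}) e m :
    coprimep q q^`() -> p ^+ 2 %| (q \Po 'X^(e.+1)) * 'X^m ->
  exists t, p %| 'X^t.
Proof.
set W := _ * 'X^m => /Bezout_eq1_coprimepP[[u v] /= uv] /dvdpP[r WE].
exists (m + e.+1)%N.
have pW : p %| W by rewrite WE expr2 mulrA dvdp_mulIr.
have pW' : p %| W^`().
  have -> : W^`() = p * (r^`() * p + r * p^`() + r * p^`()).
    by rewrite WE expr2 !derivM; ring.
  exact: dvdp_mulIl.
(* Both W and W' are multiples of p, hence so is X W' - m W. *)
have pq' : p %| 'X^(m + e.+1) * (q^`() \Po 'X^(e.+1)).
  rewrite -(@dvdpZr _ e.+1%:R) ?pnatr_eq0 //.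
  have -> : e.+1%:R *: ('X^(m + e.+1) * (q^`() \Po 'X^(e.+1))) =
      'X * W^`() - m%:R *: W.
    rewrite /W derivM deriv_comp !derivXn /= !scaler_nat.
    by case: m {WE pW pW' W} => [|m];
      rewrite ?mulr0n ?mulr0 /= !(exprD, exprS); ring.
  by rewrite dvdp_sub ?dvdp_mull // -mul_polyC dvdp_mull.
have pq : p %| 'X^(m + e.+1) * (q \Po 'X^(e.+1)).
  by rewrite exprD mulrC mulrA dvdp_mulr.
have one : (1 : {poly F}) \Po 'X^(e.+1) = 1 by rewrite -polyC1 comp_polyC.
rewrite -['X^_]mulr1 -one -uv comp_polyD !comp_polyM.
by rewrite mulrDr mulrCA (mulrCA _ (v \Po _)) dvdp_add // dvdp_mull.
Qed.

(** * Polynomials as elements of D, and descent of divisibility *)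

Section DyadicLaurent.
Variables (K : fieldType) (X : dyadic_roots K).
Local Notation D := (dyadic_laurent X).
Implicit Types (p q h : {poly rat}) (f g u v : D).

Lemma Xroot_not_algebraic n : ~ algebraicOver (ratK X) (Xroot X n).
Proof.
move=> algX; apply: (@Xroot_transc _ X); rewrite -(Xroot_exp X 0 n) add0n.
elim: (2 ^ n)%N => [|m IH]; first by rewrite expr0; apply: algebraic1.
by rewrite exprS; apply: algebraic_mul.
Qed.

Lemma evalX_eq0 n p : (evalX X n p == 0) = (p == 0).
Proof.
apply/idP/eqP => [p0|->]; last by rewrite /evalX rmorph0 horner0.
by apply/eqP/negPn/negP => pn0; apply: (@Xroot_not_algebraic n); exists p.
Qed.

Fact polyD_subproof n p : evalX X n p \in in_D X.
Proof. by apply/in_DP; exists n, p, 0%N; rewrite divr1. Qed.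

Definition polyD n p : D := Sub (evalX X n p) (polyD_subproof n p).

Lemma val_polyD n p : val (polyD n p) = evalX X n p.
Proof. by rewrite SubK. Qed.

Lemma valM f g : val (f * g) = val f * val g :> K.
Proof. exact: rmorphM. Qed.

Lemma polyD_lift n k p : polyD n p = polyD (n + k) (p \Po 'X^(2 ^ k)).
Proof. by apply: val_inj; rewrite !val_polyD -evalX_lift. Qed.

Lemma polyDM n p q : polyD n (p * q) = polyD n p * polyD n q.
Proof.
by apply: val_inj; rewrite rmorphM !val_polyD /evalX rmorphM hornerM.
Qed.

Lemma polyDD n p q : polyD n (p + q) = polyD n p + polyD n q.
Proof.
by apply: val_inj; rewrite rmorphD !val_polyD /evalX rmorphD hornerD.
Qed.

Lemma polyD1 n : polyD n 1 = 1.
Proof. by apply: val_inj; rewrite rmorph1 val_polyD /evalX rmorph1 hornerC. Qed.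

Lemma polyD_eq0 n p : (polyD n p == 0) = (p == 0).
Proof. by rewrite -(inj_eq val_inj) val_polyD rmorph0 evalX_eq0. Qed.

Lemma polyD_inj n : injective (polyD n).
Proof.
move=> p q /eqP; rewrite -subr_eq0 => /eqP pq; apply/eqP.
rewrite -subr_eq0 -(polyD_eq0 n) polyDD.
have -> : polyD n (- q) = - polyD n q.
  by apply: val_inj; rewrite rmorphN !val_polyD /evalX rmorphN hornerN.
by rewrite pq.
Qed.

Lemma polyDX n m : polyD n 'X^m = polyD n 'X ^+ m.
Proof. by elim: m => [|m IH]; rewrite ?expr0 ?polyD1 // !exprS polyDM IH. Qed.

Lemma val_polyDXn n m : val (polyD n 'X^m) = Xroot X n ^+ m.
Proof. by rewrite val_polyD /evalX map_polyXn hornerXn. Qed.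

Lemma polyDXn_unit n m : polyD n 'X^m \is a GRing.unit.
Proof.
rewrite polyDX unitrX //; apply/unitrPr.
have XV : (Xroot X n)^-1 \in in_D X.
  by apply/in_DP; exists n, 1, 1%N; rewrite /evalX rmorph1 hornerC div1r expr1.
exists (Sub (Xroot X n)^-1 XV : D); apply: val_inj.
by rewrite rmorphM rmorph1 /= /evalX map_polyX hornerX mulfV // Xroot_neq0.
Qed.

Lemma polyDC_unit n c : c != 0 -> polyD n c%:P \is a GRing.unit.
Proof.
move=> c0; apply/unitrPr; exists (polyD n c^-1%:P).
by rewrite -polyDM -polyCM mulfV // polyD1.
Qed.

(** The level has the form [n + k] so as to lie above a prescribed one; [u] is the inverse of a
    common monomial denominator. *)
Lemma common_level n f g : exists k u p q,
  [/\ u \is a GRing.unit, f = u * polyD (n + k) p & g = u * polyD (n + k) q].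
Proof.
have [k [m [p [q [fE gE]]]]] := laurent_common (valP f) (valP g).
exists k, (polyD k 'X^m)^-1, (p \Po 'X^(2 ^ n)), (q \Po 'X^(2 ^ n)).
have XU := polyDXn_unit k m.
have X0 : Xroot X k ^+ m != 0 by rewrite expf_neq0 // Xroot_neq0.
rewrite unitrV addnC -!polyD_lift; split=> //; apply: (mulrI XU).
  rewrite mulVKr //; apply: val_inj.
  by rewrite valM val_polyDXn fE mulrC mulfVK.
rewrite mulVKr //; apply: val_inj.
by rewrite valM val_polyDXn gE mulrC mulfVK.
Qed.

Lemma dvdp_polyD n p q : p %| q -> divides (polyD n p) (polyD n q).
Proof. by move=> /dvdpP[r ->]; exists (polyD n r); rewrite -polyDM mulrC. Qed.

(** The quotient may live at a deeper level. Clearing its denominator gives a divisibility of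
    polynomials in which X^(2^l) is substituted, and [dvdp_comp_polyXn] undoes the substitution. *)
Lemma divides_polyD n p q :
  divides (polyD n p) (polyD n q) <-> exists m, p %| q * 'X^m.
Proof.
split=> [[c]|[m /(dvdp_polyD n)]]; last first.
  by rewrite polyDM mulrC divides_unitMr // polyDXn_unit.
have /in_DP[l /(laurent_lift n)[r [m fE]]] := valP c.
move=> /(congr1 val); rewrite valM !val_polyD {}fE => E; exists m.
have E' : polyD (l + n) ((q \Po 'X^(2 ^ l)) * 'X^m) =
          polyD (l + n) ((p \Po 'X^(2 ^ l)) * r).
  rewrite !polyDM addnC -!polyD_lift addnC; apply: val_inj.
  rewrite !valM val_polyDXn !val_polyD E mulrA mulfVK //.
  by rewrite expf_neq0 // Xroot_neq0.
have l0 := prednK (expn_gt0 2 l : (0 < 2 ^ l)%N).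
move: E' => /polyD_inj E'; rewrite -(dvdp_comp_polyXn _ _ (2 ^ l).-1) l0.
(* X^m is completed to X^(2^l m), the image of X^m under the substitution. *)
rewrite comp_polyM comp_Xn_poly -exprM -l0 mulSn exprD mulrA l0 E'.
by rewrite -mulrA dvdp_mulIl.
Qed.

Lemma divides_polyD_coprime n p q : coprimep p 'X ->
  divides (polyD n p) (polyD n q) -> p %| q.
Proof.
by move=> pX /divides_polyD[m]; rewrite Gauss_dvdpl // coprimep_expr.
Qed.

End DyadicLaurent.

(** * Primes of D and their multiplicities *)

Section DyadicPrimes.
Variables (K : fieldType) (X : dyadic_roots K).
Local Notation D := (dyadic_laurent X).
Implicit Types (p q h : {poly rat}) (f g u v : D).

(** Both factors of a product are brought to one level n + k, where h(X^(2^k)) is still irreducible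
    and Euclid's lemma applies. *)
Lemma stable_prime n h : coprimep h 'X -> stable h ->
  prime_elt (polyD X n h).
Proof.
move=> hX hs; have hi := stable_irreducible hs.
split; first by rewrite polyD_eq0 irredp_neq0.
  apply/negP => /(@divides_unitl _ _ (polyD X n 1)) /(divides_polyD_coprime hX).
  by apply/negP; rewrite -(expr0 'X) irreducible_ndvdXn.
move=> a b; have [k [u [p [q [uU -> ->]]]]] := common_level n a b.
rewrite mulrACA -polyDM !divides_unitMr ?unitrM ?uU // (polyD_lift _ n k).
have hkX : coprimep (h \Po 'X^(2 ^ k)) 'X.
  by rewrite -exp2_pred coprimepX_comp.
move=> /(divides_polyD_coprime hkX); rewrite irreducible_dvdM //.
by case/orP => /(dvdp_polyD X (n + k)); [left | right].
Qed.

Lemma monic_R_polyD n p : p \is monic -> p`_0 != 0 -> monic_R (polyD X n p).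
Proof. by move=> pm p0; exists n, p; rewrite val_polyD. Qed.

Lemma prime_divisor_irreducible n q : irreducible_poly q -> coprimep q 'X ->
  exists2 a : D, monic_primes a & divides a (polyD X n q).
Proof.
move=> qi qX; have [j [h [hq hs]]] := stable_descendant qi qX.
have hX : coprimep h 'X.
  by apply: coprimep_dvdr hq _; rewrite -exp2_pred coprimepX_comp.
have l0 : (lead_coef h)^-1 != 0.
  by rewrite invr_eq0 lead_coef_eq0 irredp_neq0 //; apply: stable_irreducible.
pose h1 := (lead_coef h)^-1 *: h.
have h1X : coprimep h1 'X by rewrite coprimepZl.
exists (polyD X (n + j) h1).
  split; last by apply: stable_prime => //; apply: stableZ.
  apply: monic_R_polyD; last by rewrite -coprimepX_coef0.
  by rewrite monicE lead_coefZ mulVf // -invr_eq0.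
by rewrite (polyD_lift _ n j); apply: dvdp_polyD; rewrite dvdpZl.
Qed.

(** The element a may live at a deeper level, but q is separable, so a square dividing q(X^(2^k))
    times a power of X is that of a divisor of a power of X, a unit of D. *)
Lemma irreducible_squarefree n q (a : D) : irreducible_poly q ->
  a \isn't a GRing.unit -> ~ divides (a ^+ 2) (polyD X n q).
Proof.
move=> qi /negP aU [c]; have [k [u [p [r [uU aE ->]]]]] := common_level n a c.
move=> qE; apply: aU; have qc := irreducible_coprime_deriv qi.
have : divides (polyD X (n + k) (p ^+ 2)) (polyD X (n + k) (q \Po 'X^(2 ^ k))).
  rewrite -polyD_lift qE aE; exists (u ^+ 3 * polyD X (n + k) r).
  by rewrite !expr2 polyDM !exprS; ring.
move=> /divides_polyD[m]; rewrite -exp2_pred.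
move=> /(sqr_dvdp_comp_polyXn qc)[t /(dvdp_polyD X (n + k))].
by move=> /(divides_unit (polyDXn_unit _ _ _)) pU; rewrite aE unitrM uU.
Qed.

Lemma prime_pow_shift n q (a : D) : irreducible_poly q -> prime_elt a ->
  exists e, forall k f,
    divides (a ^+ (e + k)) (polyD X n q * f) <-> divides (a ^+ k) f.
Proof.
move=> qi ap; apply: squarefree_pow_dividesM => //.
by apply: irreducible_squarefree => //; case: ap.
Qed.

(** Each irreducible factor of p shifts the multiplicity by a finite amount. *)
Lemma prime_pow_bounded n p (a : D) : prime_elt a -> p != 0 ->
  exists k, ~ divides (a ^+ k) (polyD X n p).
Proof.
move=> ap; move: p; apply: poly_factor_ind => [c c0|q p qi p0 [k nk]].
  exists 1%N; rewrite expr1 => /(divides_unit (polyDC_unit _ _ c0)).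
  by apply/negP; case: ap.
have [e eP] := prime_pow_shift n qi ap.
by exists (e + k)%N; rewrite polyDM eP.
Qed.

(* An irreducible q coprime to X has a prime divisor in D, whose multiplicity *)
(* in q is one, so the prime multiplicities see every factor of a polynomial. *)
Lemma divides_of_prime_pows n p q : p != 0 ->
    (forall (a : D) k, monic_primes a -> divides (a ^+ k) (polyD X n p) ->
       divides (a ^+ k) (polyD X n q)) ->
  divides (polyD X n p) (polyD X n q).
Proof.
move=> p0; move: p p0 q.
apply: (poly_factor_ind (P := fun p => forall q, _ -> divides (polyD X n p) _)).
  by move=> c c0 q _; apply/divides_unitl/polyDC_unit.
move=> r p ri p0 IH q pq; have [rX|] := boolP (coprimep r 'X); last first.
  rewrite irreducible_poly_coprime // negbK => /(dvdp_polyD X n).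
  move=> /(divides_unit (polyDXn_unit _ _ 1)) rU.
  rewrite polyDM divides_unitMl //; apply: IH => a k aS ap.
  by apply: pq => //; rewrite polyDM; apply: divides_mull.
have rq : r %| q.
  have [//|] := boolP (r %| q); rewrite -irreducible_poly_coprime //.
  (* If r and q were coprime, a prime of D dividing r would divide q by hypothesis, hence 1. *)
  move=> /Bezout_eq1_coprimepP[[x y] /= xy].
  have [a aS ar] := prime_divisor_irreducible n ri rX.
  have aq : divides a (polyD X n q).
    rewrite -(expr1 a); apply: pq => //.
    by rewrite expr1 polyDM; apply: divides_mulr.
  have : divides a (polyD X n 1).
    by rewrite -xy polyDD !polyDM; apply: dividesD; apply: divides_mull.
  rewrite polyD1 => /(divides_unit (unitr1 _)) aU.
  by case: aS => _ [_ /negP].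
case/dvdpP: rq pq => s ->; rewrite (mulrC s) => pq; rewrite !polyDM.
rewrite divides_mul2l ?polyD_eq0 ?irredp_neq0 //; apply: IH => a k aS ap.
have [e eP] := prime_pow_shift n ri aS.2.
by rewrite -eP -polyDM; apply: pq => //; rewrite polyDM eP.
Qed.

(** * Monic normal form, and the infinite product *)

Lemma polyD_factorX n p : p != 0 ->
  exists u q, [/\ u \is a GRing.unit, q \is monic, q`_0 != 0 &
    polyD X n p = u * polyD X n q].
Proof.
move=> p0; have [m [q]] := multiplicity_XsubC p 0.
rewrite p0 /= subr0 => q0 pE.
have qn0 : q != 0 by apply: contraNneq q0 => ->; rewrite root0.
have l0 : lead_coef q != 0 by rewrite lead_coef_eq0.
exists (polyD X n ((lead_coef q)%:P * 'X^m)), ((lead_coef q)^-1 *: q); split.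
- by rewrite polyDM unitrM polyDC_unit // polyDXn_unit.
- by rewrite monicE lead_coefZ mulVf.
- by rewrite -coprimepX_coef0 coprimepZl ?invr_eq0 // coprimepX.
- by rewrite -polyDM mulrAC mul_polyC scalerA mulfV // scale1r -pE.
Qed.

Lemma monic_R_neq0 f : monic_R f -> f != 0.
Proof.
case=> n [p [pm _ fE]]; rewrite -(inj_eq val_inj) fE rmorph0 evalX_eq0.
exact: monic_neq0.
Qed.

(** At a common level both are monic polynomials coprime to X, so mutual divisibility in D is mutual
    divisibility in Q[X]. *)
Lemma monic_R_divides_eq f g : monic_R f -> monic_R g ->
  divides f g -> divides g f -> f = g.
Proof.
have lvl f' : monic_R f' -> exists n, forall k,
    exists p, [/\ p \is monic, coprimep p 'X & f' = polyD X (n + k) p].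
  case=> n [p [pm p0 fE]]; exists n => k; exists (p \Po 'X^(2 ^ k)); split.
  - rewrite monicE lead_coef_comp ?size_polyXn ?ltnS ?expn_gt0 //.
    by rewrite lead_coefXn expr1n mulr1.
  - by rewrite -exp2_pred coprimepX_comp // coprimepX_coef0.
  - by apply: val_inj; rewrite -polyD_lift val_polyD.
move=> /lvl[n fP] /lvl[m gP]; have [p [pm pX ->]] := fP m.
have [q [qm qX ->]] := gP n; rewrite addnC.
move=> /(divides_polyD_coprime pX) pq /(divides_polyD_coprime qX) qp.
by congr polyD; apply/eqP; rewrite -eqp_monic // /eqp pq qp.
Qed.

Lemma unit_part_unique f : f != 0 -> exists u, unique (unit_part f) u.
Proof.
move=> f0; have [n [v [p [_ [vU fE _]]]]] := common_level 0 f f.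
have p0 : p != 0.
  by move: f0; rewrite fE mulf_eq0 polyD_eq0 negb_or => /andP[].
have [w [q [wU qm q0 pE]]] := polyD_factorX (0 + n) p0.
exists (v * w); split.
  split; first by rewrite unitrM vU.
  by exists (polyD X (0 + n) q); [exact: monic_R_polyD | rewrite fE pE mulrA].
have gR := monic_R_polyD (0 + n) qm q0.
move=> u [uU [f1 f1R fE']].
have E : u * f1 = v * w * polyD X (0 + n) q by rewrite -fE' fE pE mulrA.
have vwU : v * w \is a GRing.unit by rewrite unitrM vU.
have f1E : polyD X (0 + n) q = f1.
  apply: monic_R_divides_eq => //.
    apply/(divides_unitMr _ _ uU); rewrite E.
    exact/divides_mull/divides_refl.
  apply/(divides_unitMr _ _ vwU); rewrite -E.
  exact/divides_mull/divides_refl.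
by apply: (mulIf (monic_R_neq0 f1R)); rewrite E f1E.
Qed.

Lemma exact_pow_prime f (a : D) : f != 0 -> prime_elt a ->
  exists k, exact_pow a k f.
Proof.
move=> f0 ap; apply: exact_pow_exists.
have [n [v [p [_ [vU fE _]]]]] := common_level 0 f f.
have p0 : p != 0.
  by move: f0; rewrite fE mulf_eq0 polyD_eq0 negb_or => /andP[].
have [k nk] := prime_pow_bounded (0 + n) ap p0.
by exists k; rewrite fE divides_unitMr.
Qed.

Lemma divides_of_exact_pows f g (k : monic_primes (X := X) -> nat) : f != 0 ->
    (forall a, exact_pow (val a) (k a) f) ->
    (forall a, exact_pow (val a) (k a) g) ->
  divides f g.
Proof.
have [n [u [p [q [uU -> ->]]]]] := common_level 0 f g.
rewrite mulf_eq0 polyD_eq0 negb_or => /andP[_ p0] fk gk.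
rewrite divides_unitMl // divides_unitMr //.
apply: divides_of_prime_pows => // a j aS aj.
pose a' : monic_primes (X := X) := SigSub (mem_set aS).
have [gk' _] := gk a'; rewrite divides_unitMr // in gk'.
apply: divides_trans gk'; apply: divides_exp2l; apply: (exact_pow_ge (fk a')).
by rewrite divides_unitMr.
Qed.

Lemma countable_dyadic (S : set D) : countable S.
Proof.
have codeP (f : D) : exists c : nat * {poly rat} * nat,
    val f = evalX X c.1.1 c.1.2 / Xroot X c.1.1 ^+ c.2.
  by have /in_DP[n [p [m fE]]] := valP f; exists (n, p, m).
apply/countable_injP; exists (fun f => pickle (sval (cid (codeP f)))).
move=> f g _ _ /(pcan_inj pickleK).
case: cid => c fE; case: cid => c' gE /= cc.
by apply: val_inj; rewrite fE gE cc.
Qed.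

End DyadicPrimes.

Theorem theorem5p7 (K : fieldType) (X : dyadic_roots K) :
  countable (@monic_primes K X) /\
  forall f : dyadic_laurent X, f != 0 -> f \isn't a GRing.unit ->
    exists2 u : dyadic_laurent X,
      unique (unit_part (X := X) f) u &
      exists! k : @monic_primes K X -> nat, is_inf_prod f u k.
Proof.
split=> [|f f0 _]; first exact: countable_dyadic.
have [u uP] := unit_part_unique f0; exists u => //.
have kP (a : @monic_primes K X) : exists k, exact_pow (val a) k f.
  by apply: exact_pow_prime => //; case: (set_mem (valP a)).
pose k a := sval (cid (kP a)).
have fk a : exact_pow (val a) (k a) f by rewrite /k; case: cid.
exists k; split.
  split=> //; first by case: uP.
  move=> g gk _ [x _ <-]; have [y ->] := divides_of_exact_pows f0 fk gk.
  by exists (y * x); rewrite // mulrA.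
(* Two exact exponents of the same prime in f bound each other. *)
move=> k' [_ fk' _]; apply/funext => a; apply/eqP; rewrite eqn_leq.
by rewrite (exact_pow_ge (fk' a) (fk a).1) (exact_pow_ge (fk a) (fk' a).1).
Qed.
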